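(* Let $U$ be a unitary on an $n$-qubit system $S$ containing a $k$-qubit logical system $L$, with encoding $\mathcal E(\psi)=U[\psi_L\otimes|0\rangle\langle0|_{S\setminus L}]U^\dagger$, let $\mathcal N$ be a noise channel on $S$ and $\mathcal D$ a decoding channel to $L$, and let $F_{\mathrm{Choi}}=F\big(\hat\phi_{LR},[(\mathcal D\circ\mathcal N\circ\mathcal E)_L\otimes I_R](\hat\phi_{LR})\big)$ be the entanglement fidelity of $\mathcal D\circ\mathcal N\circ\mathcal E$. For a $k$-qubit Pauli matrix $P$ on $L$ define $$\mathcal E_P(\psi)=U[(P\psi P^\dagger)_L\otimes|0\rangle\langle0|_{S\setminus L}]U^\dagger,\qquad\mathcal D_P(\psi)=P\,\mathcal D(\psi)P^\dagger .$$ Then for any input state $\psi_{LR}$, $$\mathbb E_PF\big(\psi_{LR},[(\mathcal D_P\circ\mathcal N\circ\mathcal E_P)_L\otimes I_R](\psi_{LR})\big)\ge F_{\mathrm{Choi}},$$ where the expectation is over all $k$-qubit Pauli matrices $P$ uniformly at random.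
   Context: $F(\rho,\sigma)=\Vert\sqrt\rho\sqrt\sigma\Vert_1$ (root fidelity). $R$ is a reference system; $\hat\phi_{LR}$ is the maximally entangled state between $L$ and a $k$-qubit reference. $|0\rangle_{S\setminus L}$ is the all-zero state of the ancillary qubits. The $k$-qubit Pauli matrices are the $4^k$ tensor products of $I,X,Y,Z$. *)

(* Defs.v *)
From mathcomp Require Import all_boot all_order all_algebra.
From mathcomp Require Export reals complex.
From mathcomp Require Import mxtens.

Set Implicit Arguments.
Unset Strict Implicit.
Unset Printing Implicit Defensive.

Import Order.TTheory GRing.Theory Num.Theory.
Local Open Scope ring_scope.

Section Matrices.
Variable C : numClosedFieldType.

Definition adjmx m n (A : 'M[C]_(m, n)) : 'M[C]_(n, m) := map_mx Num.conj A^T.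

(* [0 <= z] in C entails that z is real. *)
Definition psdmx n (A : 'M[C]_n) : Prop :=
  (A \is hermsymmx) /\ (forall v : 'rV[C]_n, 0 <= (v *m A *m adjmx v) 0 0).

(* The positive square root of a positive semidefinite A: since
   A = P^-1 diag(sp) P with P unitary, take the nonnegative square roots of
   the eigenvalues.  Only meaningful when A is positive semidefinite. *)
Definition sqrtmx n (A : 'M[C]_n) : 'M[C]_n :=
  let P := spectralmx A in
  invmx P *m diag_mx (map_mx sqrtC (spectral_diag A)) *m P.

(* ||A||_1 = tr sqrt(A^dagger A); a nonnegative real number, seen in C. *)
Definition trace_norm n (A : 'M[C]_n) : C := \tr (sqrtmx (adjmx A *m A)).

Definition fidelity n (rho sigma : 'M[C]_n) : C :=
  trace_norm (sqrtmx rho *m sqrtmx sigma).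

Definition is_state n (rho : 'M[C]_n) : Prop := psdmx rho /\ \tr rho = 1.

(* (Phi (x) I_R)(X) for a reference of dimension r: writing
   X = \sum_(a, b) X_ab (x) |a><b|, this is \sum_(a, b) Phi(X_ab) (x) |a><b|. *)
Definition ext_ref (m n r : nat) (Phi : 'M[C]_m -> 'M[C]_n)
    (X : 'M[C]_(m * r)) : 'M[C]_(n * r) :=
  \sum_(a < r) \sum_(b < r)
    tensmx (Phi (\matrix_(i < m, j < m)
                   X (mxtens_index (i, a)) (mxtens_index (j, b))))
           (delta_mx a b).

Definition completely_positive m n (Phi : 'M[C]_m -> 'M[C]_n) : Prop :=
  forall (r : nat) (X : 'M[C]_(m * r)), psdmx X -> psdmx (ext_ref Phi X).

Definition trace_preserving m n (Phi : 'M[C]_m -> 'M[C]_n) : Prop :=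
  forall X : 'M[C]_m, \tr (Phi X) = \tr X.

Definition is_channel m n (Phi : {linear 'M[C]_m -> 'M[C]_n}) : Prop :=
  completely_positive Phi /\ trace_preserving Phi.

(* |phi><phi| with |phi> = d^(-1/2) \sum_i |i>|i>. *)
Definition max_entangled (d : nat) : 'M[C]_(d * d) :=
  d%:R^-1 *: \sum_(i < d) \sum_(j < d) tensmx (delta_mx i j) (delta_mx i j).

End Matrices.

Section Qubits.

Definition bitstring (m : nat) := {ffun 'I_m -> 'I_2}.

Lemma card_bitstring m : #|{: bitstring m}| = (2 ^ m)%N.
Proof. by rewrite card_ffun !card_ord. Qed.

(* The computational basis of m qubits: [bits] is a bijection between the
   matrix indices 'I_(2 ^ m) and the bit strings of length m.  Which bijection
   it is plays no role, as operators are only specified through bit strings. *)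
Definition bits m (x : 'I_(2 ^ m)) : bitstring m :=
  enum_val (cast_ord (esym (card_bitstring m)) x).

Definition of_bits m (b : bitstring m) : 'I_(2 ^ m) :=
  cast_ord (card_bitstring m) (enum_rank b).

Lemma bitsK m : cancel (@bits m) (@of_bits m).
Proof. by move=> x; rewrite /of_bits /bits enum_valK cast_ordKV. Qed.

Lemma of_bitsK m : cancel (@of_bits m) (@bits m).
Proof. by move=> b; rewrite /of_bits /bits cast_ordK enum_rankK. Qed.

(* The basis index of the qubits in L, when all n qubits have index x. *)
Definition restrict n (L : {set 'I_n}) (x : 'I_(2 ^ n)) : 'I_(2 ^ #|L|) :=
  of_bits [ffun j : 'I_#|L| => bits x (enum_val j)].

Variable C : numClosedFieldType.

(* A_L (x) B_(S \ L), on the n qubits of S. *)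
Definition subsys_tens n (L : {set 'I_n})
    (A : 'M[C]_(2 ^ #|L|)) (B : 'M[C]_(2 ^ #|~: L|)) : 'M[C]_(2 ^ n) :=
  \matrix_(x, y) (A (restrict L x) (restrict L y)
                  * B (restrict (~: L) x) (restrict (~: L) y)).

(* |0...0><0...0| *)
Definition zero_state m : 'M[C]_(2 ^ m) :=
  delta_mx (of_bits [ffun=> 0]) (of_bits [ffun=> 0]).

Definition pauliX : 'M[C]_2 := \matrix_(i, j) (i != j)%:R.
Definition pauliY : 'M[C]_2 :=
  \matrix_(i, j) (if i == j then 0 else if i == 0 then - 'i else 'i).
Definition pauliZ : 'M[C]_2 :=
  \matrix_(i, j) (if i == j then (-1) ^+ i else 0).

Definition pauli1 (a : 'I_4) : 'M[C]_2 :=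
  match val a with
  | 0 => 1%:M
  | 1 => pauliX
  | 2 => pauliY
  | _ => pauliZ
  end%N.

(* The tensor product of the one-qubit Pauli matrices a 0, ..., a (k - 1);
   the 4 ^ k words a index the 4 ^ k Pauli matrices bijectively. *)
Definition pauli k (a : {ffun 'I_k -> 'I_4}) : 'M[C]_(2 ^ k) :=
  \matrix_(x, y) \prod_(q < k) pauli1 (a q) (bits x q) (bits y q).

Definition pauli_mean k (f : 'M[C]_(2 ^ k) -> C) : C :=
  (4 ^ k)%:R^-1 * \sum_(a : {ffun 'I_k -> 'I_4}) f (pauli a).

Definition encode n (L : {set 'I_n}) (U : 'M[C]_(2 ^ n))
    (psi : 'M[C]_(2 ^ #|L|)) : 'M[C]_(2 ^ n) :=
  U *m subsys_tens psi (zero_state _) *m adjmx U.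

Definition encodeP n (L : {set 'I_n}) (U : 'M[C]_(2 ^ n))
    (P : 'M[C]_(2 ^ #|L|)) (psi : 'M[C]_(2 ^ #|L|)) : 'M[C]_(2 ^ n) :=
  encode U (P *m psi *m adjmx P).

Definition decodeP m d (D : 'M[C]_m -> 'M[C]_d) (P : 'M[C]_d)
    (psi : 'M[C]_m) : 'M[C]_d :=
  P *m D psi *m adjmx P.

Definition choi_fidelity d (Phi : 'M[C]_d -> 'M[C]_d) : C :=
  fidelity (max_entangled C d) (ext_ref Phi (max_entangled C d)).

End Qubits.

(* Main.v *)
(* Let phi be the maximally entangled vector, J = (Phi (x) I)(|phi><phi|) the
   Choi state of Phi = D o N o E, and f = sqrt <phi|J|phi>, so that
   F_Choi = f since phi is pure.  Define the operator T by
   (T (x) 1)|phi> = J|phi> / f.  By Cauchy-Schwarz J >= J|phi><phi|J / f^2, so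
   Phi dominates X |-> T X T^dagger, even after tensoring with a reference.
   Hence the P-twisted channel dominates conjugation by P T P, and
   F(psi, sigma) >= |tr (K psi)| whenever sigma >= K psi K^dagger.  The triangle
   inequality and the twirl E_P [P T P] = (tr T / d) 1 bound the mean fidelity
   below by |tr T| / d, which equals f. *)
Require Import Defs.
From mathcomp Require Import all_boot all_order all_algebra.
From mathcomp Require Import reals complex mxtens.

Set Implicit Arguments.
Unset Strict Implicit.
Unset Printing Implicit Defensive.

Import Order.TTheory GRing.Theory Num.Theory.
Local Open Scope ring_scope.

(** * Adjoints, positive semidefinite matrices and quadratic forms *)

Section Matrices.
Variable C : numClosedFieldType.

Lemma adjmxM m n p (A : 'M[C]_(m, n)) (B : 'M[C]_(n, p)) :
  adjmx (A *m B) = adjmx B *m adjmx A.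
Proof. by rewrite /adjmx trmx_mul map_mxM. Qed.

Lemma adjmxK m n : cancel (@adjmx C m n) (@adjmx C n m).
Proof. by move=> A; apply/matrixP => i j; rewrite !mxE conjCK. Qed.

Lemma adjmx1 n : adjmx (1%:M : 'M[C]_n) = 1%:M.
Proof. by rewrite /adjmx trmx1 map_mx1. Qed.

Lemma adjmx_hermsym n (A : 'M[C]_n) : A \is hermsymmx -> adjmx A = A.
Proof. by move/is_hermitianmxP; rewrite expr0 scale1r. Qed.

Lemma hermsym_adjmx n (A : 'M[C]_n) : adjmx A = A -> A \is hermsymmx.
Proof. by move=> h; apply/is_hermitianmxP; rewrite expr0 scale1r [RHS]h. Qed.

Lemma mulmx_adj_ge0 n (u : 'rV[C]_n) : 0 <= (u *m adjmx u) 0 0.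
Proof. by rewrite mxE sumr_ge0 // => i _; rewrite !mxE mul_conjC_ge0. Qed.

Lemma mulmx_adj_eq0 n (u : 'rV[C]_n) : (u *m adjmx u) 0 0 = 0 -> u = 0.
Proof.
rewrite mxE => /eqP; rewrite psumr_eq0; last first.
  by move=> i _; rewrite !mxE mul_conjC_ge0.
move/allP => h; apply/rowP => i; rewrite mxE.
have := h i (mem_index_enum _); rewrite !mxE mul_conjC_eq0.
by move/eqP.
Qed.

Lemma adj_CauchySchwarz n (u v : 'rV[C]_n) :
  `|(u *m adjmx v) 0 0| ^+ 2 <= (u *m adjmx u) 0 0 * (v *m adjmx v) 0 0.
Proof.
by have [] := CauchySchwarz (@dotmx C n) u v; rewrite /= !dotmxE => h _; apply: h.
Qed.

Lemma psdmx_conj m n (A : 'M[C]_n) (B : 'M[C]_(m, n)) :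
  psdmx A -> psdmx (B *m A *m adjmx B).
Proof.
case=> hA pA; split.
  by apply: hermsym_adjmx; rewrite !adjmxM adjmxK (adjmx_hermsym hA) mulmxA.
by move=> v; have := pA (v *m B); rewrite adjmxM !mulmxA.
Qed.

Lemma psdmx_gram m n (B : 'M[C]_(m, n)) : psdmx (B *m adjmx B).
Proof.
rewrite -[B in B *m _]mulmx1; apply: psdmx_conj; split.
  by apply: hermsym_adjmx; rewrite adjmx1.
by move=> v; rewrite mulmx1 mulmx_adj_ge0.
Qed.

Lemma unitarymx_adjV n (P : 'M[C]_n) : P \is unitarymx -> invmx P = adjmx P.
Proof. exact: invmx_unitary. Qed.

Lemma unitarymx_mul_adj n (P : 'M[C]_n) : P \is unitarymx -> P *m adjmx P = 1%:M.
Proof. by move/unitarymxP. Qed.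

Lemma unitarymx_adj_mul n (P : 'M[C]_n) : P \is unitarymx -> adjmx P *m P = 1%:M.
Proof.
by move=> uP; rewrite -unitarymx_adjV // mulVmx // unitarymx_unit.
Qed.

Lemma mulmx_row_adj m n p (A : 'M[C]_(m, n)) (B : 'M[C]_(p, n)) i j :
  (A *m adjmx B) i j = (row i A *m adjmx (row j B)) 0 0.
Proof. by rewrite !mxE; apply: eq_bigr => k _; rewrite !mxE. Qed.

(** * Spectral decomposition and square root of a positive semidefinite matrix *)

Section Psd.
Variables (n : nat) (A : 'M[C]_n).
Hypothesis psdA : psdmx A.
Local Notation P := (spectralmx A).
Local Notation sp := (spectral_diag A).
Let uP : P \is unitarymx. Proof. exact: spectral_unitarymx. Qed.

Lemma psd_spectralE : A = adjmx P *m diag_mx sp *m P.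
Proof.
rewrite -(unitarymx_adjV uP); apply/orthomx_spectralP.
by apply: hermitian_normalmx; case: psdA.
Qed.

Lemma psd_spectral_diagE i : sp 0 i = (row i P *m A *m adjmx (row i P)) 0 0.
Proof.
rewrite -row_mul -mulmx_row_adj {3}psd_spectralE !mulmxA unitarymx_mul_adj //.
by rewrite mul1mx -mulmxA unitarymx_mul_adj // mulmx1 mxE eqxx mulr1n.
Qed.

Lemma psd_spectral_diag_ge0 i : 0 <= sp 0 i.
Proof. by rewrite psd_spectral_diagE; case: psdA => _. Qed.

Lemma sqrtmxE : sqrtmx A = adjmx P *m diag_mx (map_mx sqrtC sp) *m P.
Proof. by rewrite /sqrtmx unitarymx_adjV. Qed.

Lemma spectral_diag_hermE (d : 'rV[C]_n) : (forall i, d 0 i \is Num.real) ->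
  adjmx (adjmx P *m diag_mx d *m P) = adjmx P *m diag_mx d *m P.
Proof.
move=> dR; rewrite !adjmxM adjmxK mulmxA; congr (_ *m _ *m _).
rewrite /adjmx tr_diag_mx map_diag_mx; congr diag_mx.
by apply/rowP => i; rewrite mxE; apply/CrealP.
Qed.

Lemma spectral_diagM (d e : 'rV[C]_n) :
  (adjmx P *m diag_mx d *m P) *m (adjmx P *m diag_mx e *m P) =
  adjmx P *m diag_mx (\row_i (d 0 i * e 0 i)) *m P.
Proof.
rewrite !mulmxA -[_ *m P *m adjmx P]mulmxA unitarymx_mul_adj // mulmx1.
by rewrite -[_ *m diag_mx d *m diag_mx e]mulmxA mulmx_diag.
Qed.

Lemma adjmx_sqrtmx : adjmx (sqrtmx A) = sqrtmx A.
Proof.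
rewrite sqrtmxE spectral_diag_hermE // => i.
by rewrite mxE ger0_real // sqrtC_ge0 psd_spectral_diag_ge0.
Qed.

Lemma sqrtmxK : sqrtmx A *m sqrtmx A = A.
Proof.
rewrite sqrtmxE spectral_diagM [RHS]psd_spectralE.
by congr (_ *m diag_mx _ *m _); apply/rowP => i; rewrite !mxE -expr2 sqrtCK.
Qed.

Lemma tr_sqrtmx : \tr (sqrtmx A) = \sum_i sqrtC (sp 0 i).
Proof.
rewrite sqrtmxE -mulmxA mxtrace_mulC -mulmxA unitarymx_mul_adj // mulmx1.
by rewrite mxtrace_diag; apply: eq_bigr => i _; rewrite mxE.
Qed.

(* Douglas' lemma: W = S^+ Y for the pseudo-inverse S^+ of S = sqrt A, whose
   eigenvalues are the inverses of those of S, with 0^-1 = 0. *)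
Lemma sqrtmx_factor m (Y : 'M[C]_(n, m)) :
  (forall v : 'rV_n,
     (v *m Y *m adjmx (v *m Y)) 0 0 <= (v *m A *m adjmx v) 0 0) ->
  exists2 W : 'M[C]_(n, m), sqrtmx A *m W = Y &
    forall v : 'rV_n, (v *m W *m adjmx (v *m W)) 0 0 <= (v *m adjmx v) 0 0.
Proof.
move=> YA.
pose s := map_mx sqrtC sp; pose si := map_mx GRing.inv s.
pose e : 'rV[C]_n := \row_i (s 0 i * si 0 i).
have s_ge0 i : 0 <= s 0 i by rewrite mxE sqrtC_ge0 psd_spectral_diag_ge0.
have siR i : si 0 i \is Num.real by rewrite mxE rpredV ger0_real.
have e01 i : e 0 i = (s 0 i != 0)%:R.
  rewrite mxE [si _ _]mxE; case: eqVneq => [->|/mulfV //]; first by rewrite mul0r.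
pose Si := adjmx P *m diag_mx si *m P.
have SSi : sqrtmx A *m Si = adjmx P *m diag_mx e *m P.
  by rewrite sqrtmxE spectral_diagM.
have SiS : Si *m sqrtmx A = adjmx P *m diag_mx e *m P.
  rewrite sqrtmxE spectral_diagM; congr (_ *m diag_mx _ *m _).
  by apply/rowP => i; rewrite !mxE mulrC.
exists (Si *m Y).
  rewrite mulmxA SSi.
  (* [e] is the 0-1 indicator of the nonzero eigenvalues, so [SSi] is the support projection of [A].
     It fixes [Y] because, by [YA], an eigenvector in the kernel of [A] also kills [Y]. *)
  have PY i : e 0 i = 0 -> row i P *m Y = 0.
    rewrite e01 => /eqP; rewrite pnatr_eq0 eqb0 negbK => /eqP si0.
    apply: mulmx_adj_eq0; apply/le_anti; rewrite mulmx_adj_ge0 andbT.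
    apply: le_trans (YA _) _; rewrite -psd_spectral_diagE.
    by move: si0; rewrite mxE => /eqP; rewrite sqrtC_eq0 => /eqP ->.
  have -> : Y = adjmx P *m (P *m Y).
    by rewrite mulmxA unitarymx_adj_mul // mul1mx.
  rewrite !mulmxA -[_ *m P *m adjmx P]mulmxA unitarymx_mul_adj // mulmx1.
  rewrite -!mulmxA; congr (_ *m _); apply/row_matrixP => i.
  rewrite row_mul row_diag_mx -scalemxAl -rowE row_mul.
  have := PY i; rewrite e01; case: eqVneq => [_ PYi|_ _]; last by rewrite scale1r.
  by rewrite scale0r PYi.
(* [YA] bounds the form of [Si *m Y] by that of this product, which is again the support projection
   and hence at most the identity. *)
have ASi : Si *m A *m adjmx Si = adjmx P *m diag_mx e *m P.
  rewrite -{1}sqrtmxK mulmxA SiS -adjmx_sqrtmx -mulmxA -adjmxM SiS.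
  rewrite spectral_diag_hermE; last by move=> i; rewrite e01 realn.
  rewrite spectral_diagM; congr (_ *m diag_mx _ *m _); apply/rowP => i.
  by rewrite mxE e01 -natrM mulnb andbb.
clearbody Si e; move=> v; rewrite mulmxA; apply: le_trans (YA _) _.
rewrite adjmxM !mulmxA -[v *m Si *m A]mulmxA -[v *m _ *m adjmx Si]mulmxA ASi.
set w := v *m adjmx P.
have -> : v *m adjmx v = w *m adjmx w.
  by rewrite adjmxM adjmxK mulmxA -[_ *m _ *m P]mulmxA unitarymx_adj_mul // mulmx1.
have -> : v *m (adjmx P *m diag_mx e *m P) *m adjmx v = w *m diag_mx e *m adjmx w.
  by rewrite adjmxM adjmxK !mulmxA.
rewrite mul_mx_diag !mxE; apply: ler_sum => i _; rewrite !mxE e01.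
by case: eqP => _; rewrite ?mulr1 // mulr0 mul0r mul_conjC_ge0.
Qed.

End Psd.

(** * Variational bounds on the trace norm and the fidelity *)

(** Take the trace in an eigenbasis of [adjmx M *m M]. By Cauchy-Schwarz and contractivity of [W],
    each diagonal entry is at most the square root of the corresponding eigenvalue. *)
Lemma trace_norm_ge n (M W : 'M[C]_n) :
  (forall v : 'rV_n, (v *m W *m adjmx (v *m W)) 0 0 <= (v *m adjmx v) 0 0) ->
  `|\tr (M *m W)| <= trace_norm M.
Proof.
move=> cW; have psdG : psdmx (adjmx M *m M).
  by rewrite -{2}[M]adjmxK; apply: psdmx_gram.
rewrite /trace_norm tr_sqrtmx //; set P := spectralmx (adjmx M *m M).
have uP : P \is unitarymx by apply: spectral_unitarymx.
have -> : \tr (M *m W) = \tr (P *m W *m adjmx (P *m adjmx M)).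
  rewrite adjmxM adjmxK mulmxA [RHS]mxtrace_mulC !mulmxA unitarymx_adj_mul //.
  by rewrite mul1mx mxtrace_mulC.
apply: le_trans (ler_norm_sum _ _ _) _; apply: ler_sum => i _.
rewrite mulmx_row_adj psd_spectral_diagE // -/P.
have sq_ge0 : 0 <= (row i P *m (adjmx M *m M) *m adjmx (row i P)) 0 0.
  by case: psdG.
rewrite -ler_sqr ?nnegrE ?normr_ge0 ?sqrtC_ge0 // sqrtCK.
apply: le_trans (adj_CauchySchwarz _ _) _.
have -> : (row i P *m (adjmx M *m M) *m adjmx (row i P)) 0 0 =
   (row i (P *m adjmx M) *m adjmx (row i (P *m adjmx M))) 0 0.
  by rewrite row_mul adjmxM adjmxK !mulmxA.
rewrite ler_piMl ?mulmx_adj_ge0 // row_mul.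
apply: le_trans (cW _) _.
by rewrite -mulmx_row_adj unitarymx_mul_adj // mxE eqxx.
Qed.

(** Domination lets [T *m sqrtmx rho] factor as [sqrtmx sigma *m W] with [W] a contraction.
    Cyclicity then writes the trace as that of [sqrtmx rho *m sqrtmx sigma *m W], where
    [trace_norm_ge] applies. *)
Lemma fidelity_ge n (rho sigma T : 'M[C]_n) : psdmx rho -> psdmx sigma ->
  (forall v : 'rV_n, (v *m (T *m rho *m adjmx T) *m adjmx v) 0 0
                     <= (v *m sigma *m adjmx v) 0 0) ->
  `|\tr (T *m rho)| <= fidelity rho sigma.
Proof.
move=> prho psigma hT.
have [|W SW cW] := @sqrtmx_factor _ _ psigma _ (T *m sqrtmx rho).
  move=> v; apply: le_trans (hT v).
  rewrite adjmxM [adjmx (T *m _)]adjmxM adjmx_sqrtmx //.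
  by rewrite -[in X in _ <= X](sqrtmxK prho) !mulmxA lexx.
suff -> : \tr (T *m rho) = \tr ((sqrtmx rho *m sqrtmx sigma) *m W).
  by rewrite /fidelity; apply: trace_norm_ge.
by rewrite -mulmxA SW [RHS]mxtrace_mulC -mulmxA sqrtmxK.
Qed.

(** For a pure first argument the Gram matrix under the trace norm has rank at most one: it is
    [adjmx w *m w] with [w = u *m sqrtmx sigma]. *)
Lemma fidelity_pure_le n (u : 'rV[C]_n) (sigma : 'M[C]_n) : psdmx sigma ->
  fidelity (adjmx u *m u) sigma <= sqrtC ((u *m sigma *m adjmx u) 0 0).
Proof.
move=> psdS.
have psdu : psdmx (adjmx u *m u) by rewrite -{2}[u]adjmxK; apply: psdmx_gram.
rewrite /fidelity /trace_norm.
have := sqrtmxK psdS; have := adjmx_sqrtmx psdS.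
have := sqrtmxK psdu; have := adjmx_sqrtmx psdu.
move: (sqrtmx _) (sqrtmx sigma) => Q S adjQ QQ adjS SS.
rewrite adjmxM adjQ adjS -mulmxA [Q *m (Q *m S)]mulmxA QQ -SS.
set w := u *m S.
have -> : u *m (S *m S) *m adjmx u = w *m adjmx w by rewrite adjmxM adjS !mulmxA.
have -> : S *m (adjmx u *m u *m S) = adjmx w *m w by rewrite adjmxM adjS !mulmxA.
clearbody w; set c := (w *m adjmx w) 0 0.
have c_ge0 : 0 <= c by apply: mulmx_adj_ge0.
have pw : psdmx (adjmx w *m w) by rewrite -{2}[w]adjmxK; apply: psdmx_gram.
rewrite tr_sqrtmx //; set sp := spectral_diag _.
set P := spectralmx (adjmx w *m w).
have uP : P \is unitarymx by apply: spectral_unitarymx.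
have Psp : P *m (adjmx w *m w) *m adjmx P = diag_mx sp.
  rewrite (psd_spectralE pw) -/P -/sp !mulmxA unitarymx_mul_adj // mul1mx.
  by rewrite -mulmxA unitarymx_mul_adj // mulmx1.
have sum_sp : \sum_i sp 0 i = c.
  rewrite -mxtrace_diag -Psp mxtrace_mulC !mulmxA unitarymx_adj_mul // mul1mx.
  by rewrite mxtrace_mulC /mxtrace big_ord1.
(* The square of [adjmx w *m w] is [c] times itself, so every eigenvalue is 0 or [c]. *)
have spE i : sp 0 i * sp 0 i = c * sp 0 i.
  have : diag_mx sp *m diag_mx sp = c *: diag_mx sp.
    rewrite -Psp !mulmxA -[_ *m adjmx P *m P]mulmxA unitarymx_adj_mul // mulmx1.
    rewrite -[_ *m w *m adjmx w]mulmxA [w *m adjmx w]mx11_scalar -/c mul_mx_scalar.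
    by rewrite -!scalemxAl.
  by rewrite mulmx_diag => /matrixP/(_ i i); rewrite !mxE eqxx !mulr1n.
(* On the values 0 and [c] the square root is linear, which turns the sum of roots into a trace. If
   [c = 0], all eigenvalues vanish and both sides are 0. *)
have sqrt_spE i : sqrtC (sp 0 i) = sp 0 i / sqrtC c.
  have /eqP := spE i; rewrite -subr_eq0 -mulrBl mulf_eq0 subr_eq0.
  have [->|sp0 /= ] := eqVneq (sp 0 i) 0; first by rewrite sqrtC0 mul0r.
  rewrite orbF => /eqP spc; rewrite -spc -{2}[sp 0 i]sqrtCK expr2 mulfK //.
  by rewrite sqrtC_eq0.
under eq_bigr do rewrite sqrt_spE.
rewrite -mulr_suml sum_sp; have [->|c0] := eqVneq c 0.
  by rewrite mul0r sqrtC_ge0.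
by rewrite -{1}[c]sqrtCK expr2 mulfK // sqrtC_eq0.
Qed.

End Matrices.

(** * Extension of maps by a reference system *)

Section ExtRef.
Variable C : numClosedFieldType.

Lemma sum_mxtens (V : nmodType) m r (F : 'I_(m * r) -> V) :
  \sum_k F k = \sum_i \sum_a F (mxtens_index (i, a)).
Proof.
rewrite pair_big /= (reindex (@mxtens_index m r)) /=.
  by apply: eq_bigr => -[].
by exists (@mxtens_unindex m r) => k _; rewrite ?mxtens_indexK ?mxtens_unindexK.
Qed.

Lemma eq_mxtens (T : Type) m n p q (A B : 'M[T]_(m * n, p * q)) :
  (forall i a j b, A (mxtens_index (i, a)) (mxtens_index (j, b)) =
                   B (mxtens_index (i, a)) (mxtens_index (j, b))) -> A = B.
Proof.
move=> AB; apply/matrixP => k l.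
by case: (mxtens_indexP k) => i a; case: (mxtens_indexP l) => j b.
Qed.

Definition blockmx m r (X : 'M[C]_(m * r)) a b : 'M[C]_m :=
  \matrix_(i, j) X (mxtens_index (i, a)) (mxtens_index (j, b)).

Lemma ext_refE m n r (Phi : 'M[C]_m -> 'M[C]_n) (X : 'M[C]_(m * r)) x a y b :
  ext_ref Phi X (mxtens_index (x, a)) (mxtens_index (y, b)) =
  Phi (blockmx X a b) x y.
Proof.
rewrite /ext_ref summxE (bigD1 a) //= [X in _ + X]big1 ?addr0; last first.
  move=> a' ne; rewrite summxE big1 // => b' _.
  by rewrite tensmxE mxE eq_sym (negbTE ne) mulr0.
rewrite summxE (bigD1 b) //= [X in _ + X]big1 ?addr0; last first.
  by move=> b' ne; rewrite tensmxE mxE [b == _]eq_sym (negbTE ne) andbF mulr0.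
by rewrite tensmxE mxE !eqxx mulr1.
Qed.

Lemma blockmx_ext_ref m n r (Phi : 'M[C]_m -> 'M[C]_n) (X : 'M[C]_(m * r)) a b :
  blockmx (ext_ref Phi X) a b = Phi (blockmx X a b).
Proof. by apply/matrixP => x y; rewrite mxE ext_refE. Qed.

Lemma ext_ref_comp m n p r (Phi : 'M[C]_n -> 'M[C]_p) (Psi : 'M[C]_m -> 'M[C]_n)
    (X : 'M[C]_(m * r)) :
  ext_ref (Phi \o Psi) X = ext_ref Phi (ext_ref Psi X).
Proof. by apply: eq_mxtens => x a y b; rewrite !ext_refE blockmx_ext_ref. Qed.

Lemma eq_ext_ref m n r (Phi Psi : 'M[C]_m -> 'M[C]_n) (X : 'M[C]_(m * r)) :
  Phi =1 Psi -> ext_ref Phi X = ext_ref Psi X.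
Proof. by move=> e; apply: eq_mxtens => x a y b; rewrite !ext_refE e. Qed.

(** The map with the single Kraus operator [T], packaged as linear so that its composites with
    channels are linear too. *)
Definition conjmap m n (T : 'M[C]_(n, m)) : {linear 'M[C]_m -> 'M[C]_n} :=
  mulmxr (adjmx T) \o mulmx T.

Definition liftmx m n r (T : 'M[C]_(n, m)) : 'M[C]_(n * r, m * r) :=
  tensmx T 1%:M.

Lemma liftmxE m n r (T : 'M[C]_(n, m)) x (a : 'I_r) i b :
  liftmx r T (mxtens_index (x, a)) (mxtens_index (i, b)) = T x i * (a == b)%:R.
Proof. by rewrite tensmxE mxE. Qed.

Lemma liftmxM m n p r (S : 'M[C]_(m, n)) (T : 'M[C]_(n, p)) :
  liftmx r (S *m T) = liftmx r S *m liftmx r T.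
Proof. by rewrite /liftmx tensmx_mul mulmx1. Qed.

Lemma adjmx_liftmx m n r (T : 'M[C]_(n, m)) :
  adjmx (liftmx r T) = liftmx r (adjmx T).
Proof.
apply: eq_mxtens => i a j b; rewrite [RHS]liftmxE [LHS]mxE [X in X^*]mxE liftmxE.
by rewrite rmorphM rmorph_nat eq_sym !mxE.
Qed.

(** [liftmx r T] is diagonal in the reference index, so one term of each reference sum survives.
    Complete positivity of [conjmap T] thereby reduces to [psdmx_conj]. *)
Lemma ext_ref_conj m n r (T : 'M[C]_(n, m)) (X : 'M[C]_(m * r)) :
  ext_ref (conjmap T) X = liftmx r T *m X *m adjmx (liftmx r T).
Proof.
apply: eq_mxtens => x a y b; rewrite ext_refE /= adjmx_liftmx mxE.
rewrite [RHS]mxE sum_mxtens; apply: eq_bigr => j _.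
rewrite (bigD1 b) //= [X in _ + X]big1 ?addr0; last first.
  by move=> b' ne; rewrite liftmxE (negbTE ne) !mulr0.
rewrite liftmxE eqxx mulr1; congr (_ * _).
rewrite !mxE sum_mxtens; apply: eq_bigr => i _.
rewrite (bigD1 a) //= [X in _ + X]big1 ?addr0; last first.
  by move=> a' ne; rewrite liftmxE eq_sym (negbTE ne) mulr0 mul0r.
by rewrite liftmxE eqxx mulr1 mxE.
Qed.

Lemma formE n (M : 'M[C]_n) (w : 'rV[C]_n) :
  (w *m M *m adjmx w) 0 0 = \sum_k \sum_l w 0 k * M k l * (w 0 l)^*.
Proof.
rewrite mxE exchange_big; apply: eq_bigr => l _ /=.
by rewrite !mxE mulr_suml.
Qed.

(** * The maximally entangled state as a pure state *)

Section MaxEnt.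
Variable d : nat.

(** The bra of the maximally entangled state; its entries are real, so it is also the transpose of
    the ket. *)
Definition max_entangled_vec : 'rV[C]_(d * d) :=
  \row_k (sqrtC d%:R^-1 * ((mxtens_unindex k).1 == (mxtens_unindex k).2)%:R).

Lemma max_entangled_vecE i j :
  max_entangled_vec 0 (mxtens_index (i, j)) = sqrtC d%:R^-1 * (i == j)%:R.
Proof. by rewrite mxE mxtens_indexK. Qed.

Lemma sqrt_dV : sqrtC d%:R^-1 * sqrtC d%:R^-1 = d%:R^-1 :> C.
Proof. by rewrite -expr2 sqrtCK. Qed.

Lemma conj_sqrt_dV : (sqrtC d%:R^-1)^* = sqrtC d%:R^-1 :> C.
Proof. by apply/CrealP; rewrite ger0_real // sqrtC_ge0 invr_ge0 ler0n. Qed.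

Lemma max_entangledE i j k l :
  max_entangled C d (mxtens_index (i, j)) (mxtens_index (k, l)) =
  d%:R^-1 * ((i == j) && (k == l))%:R.
Proof.
rewrite mxE; congr (_ * _); rewrite summxE (bigD1 i) //= [X in _ + X]big1 ?addr0.
  rewrite summxE (bigD1 k) //= [X in _ + X]big1 ?addr0.
    by rewrite tensmxE !mxE !eqxx mul1r eq_sym [l == _]eq_sym.
  by move=> k' ne; rewrite tensmxE !mxE [k == _]eq_sym (negbTE ne) andbF mul0r.
move=> i' ne; rewrite summxE big1 // => k' _.
by rewrite tensmxE !mxE eq_sym (negbTE ne) mul0r.
Qed.

Lemma max_entangled_pure :
  max_entangled C d = adjmx max_entangled_vec *m max_entangled_vec.
Proof.
apply: eq_mxtens => i j k l; rewrite max_entangledE mxE big_ord1.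
rewrite [adjmx _ _ _]mxE [_^T _ _]mxE !max_entangled_vecE rmorphM /=.
rewrite conj_sqrt_dV rmorph_nat.
by rewrite mulrACA sqrt_dV -natrM mulnb.
Qed.

Lemma blockmx_max_entangled i j :
  blockmx (max_entangled C d) i j = d%:R^-1 *: delta_mx i j.
Proof. by apply/matrixP => k l; rewrite mxE max_entangledE !mxE. Qed.

End MaxEnt.

(* Writing the l-th column of S as sqrt m (1 (x) V_l)|phi>, this is the quadratic
   form of (Phi (x) I)(S S^dagger) = m \sum_l (1 (x) V_l) J (1 (x) V_l)^dagger. *)
Lemma ext_ref_form m n r p (Phi : {linear 'M[C]_m -> 'M[C]_n})
    (S : 'M[C]_(m * r, p)) (w : 'rV[C]_(n * r)) : (0 < m)%N ->
  let g l : 'rV_(n * m) := \row_k \sum_a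
     w 0 (mxtens_index ((mxtens_unindex k).1, a)) *
     S (mxtens_index ((mxtens_unindex k).2, a)) l in
  (w *m ext_ref Phi (S *m adjmx S) *m adjmx w) 0 0 =
  m%:R * \sum_l (g l *m ext_ref Phi (max_entangled C m) *m adjmx (g l)) 0 0.
Proof.
move=> m_gt0 g; have m_neq0 : m%:R != 0 :> C by rewrite pnatr_eq0 -lt0n.
have gE l x i : g l 0 (mxtens_index (x, i)) =
    \sum_a w 0 (mxtens_index (x, a)) * S (mxtens_index (i, a)) l.
  by rewrite mxE mxtens_indexK.
have PhiE X x y : Phi X x y = \sum_i \sum_j X i j * Phi (delta_mx i j) x y.
  rewrite {1}[X]matrix_sum_delta linear_sum summxE; apply: eq_bigr => i _.
  rewrite linear_sum summxE; apply: eq_bigr => j _.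
  by rewrite linearZ mxE.
(* The common summand of both sides once [Phi] is expanded on matrix units; on the right the factor
   [m%:R] cancels the normalisation of the maximally entangled state. The rest reorders sums. *)
pose t x y a b i j l := w 0 (mxtens_index (x, a)) * S (mxtens_index (i, a)) l *
  Phi (delta_mx i j) x y * (w 0 (mxtens_index (y, b)) * S (mxtens_index (j, b)) l)^*.
transitivity (\sum_x \sum_a \sum_y \sum_b \sum_i \sum_j \sum_l t x y a b i j l).
  rewrite formE sum_mxtens; apply: eq_bigr => x _; apply: eq_bigr => a _.
  rewrite sum_mxtens; apply: eq_bigr => y _; apply: eq_bigr => b _.
  rewrite ext_refE PhiE mulr_sumr mulr_suml; apply: eq_bigr => i _.
  rewrite mulr_sumr mulr_suml; apply: eq_bigr => j _.
  rewrite !mxE mulr_suml mulr_sumr mulr_suml; apply: eq_bigr => l _.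
  rewrite !mxE /t rmorphM /= -!mulrA; congr (_ * (_ * _)).
  by rewrite mulrCA; congr (_ * _); rewrite mulrC.
transitivity (\sum_l \sum_x \sum_i \sum_y \sum_j \sum_a \sum_b t x y a b i j l);
  last first.
  rewrite mulr_sumr; apply: eq_bigr => l _.
  rewrite formE sum_mxtens mulr_sumr; apply: eq_bigr => x _.
  rewrite mulr_sumr; apply: eq_bigr => i _.
  rewrite sum_mxtens mulr_sumr; apply: eq_bigr => y _.
  rewrite mulr_sumr; apply: eq_bigr => j _.
  rewrite ext_refE blockmx_max_entangled linearZ /=.
  rewrite [fun_of_matrix (_ *: _) _ _]mxE !gE.
  rewrite [_ * (m%:R^-1 * _)]mulrCA -[m%:R^-1 * _ * _]mulrA mulVKf //.
  rewrite rmorph_sum mulr_suml mulr_suml; apply: eq_bigr => a _.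
  by rewrite mulr_sumr; apply: eq_bigr.
rewrite [RHS]exchange_big; apply: eq_bigr => x _ /=.
under [RHS]eq_bigr do rewrite exchange_big /=.
rewrite exchange_big [RHS]exchange_big; apply: eq_bigr => y _ /=.
under [RHS]eq_bigr do
  (under eq_bigr do rewrite exchange_big /=; rewrite exchange_big /=).
rewrite [RHS]exchange_big; apply: eq_bigr => a _ /=.
under [RHS]eq_bigr do
  (under eq_bigr do rewrite exchange_big /=; rewrite exchange_big /=).
rewrite [RHS]exchange_big; apply: eq_bigr => b _ /=.
rewrite [RHS]exchange_big; apply: eq_bigr => i _ /=.
by rewrite [RHS]exchange_big.
Qed.

End ExtRef.

(** * A Kraus operator extracted from the Choi state *)

Section Choi.
Variable C : numClosedFieldType.

Lemma choi_dominating_operator d (Phi : {linear 'M[C]_d -> 'M[C]_d}) :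
  (0 < d)%N -> psdmx (ext_ref Phi (max_entangled C d)) ->
  exists2 T : 'M[C]_d, d%:R * choi_fidelity Phi <= `|\tr T| &
    forall r (X : 'M[C]_(d * r)) (w : 'rV[C]_(d * r)), psdmx X ->
      (w *m (liftmx r T *m X *m adjmx (liftmx r T)) *m adjmx w) 0 0 <=
      (w *m ext_ref Phi X *m adjmx w) 0 0.
Proof.
move=> d_gt0; set J := ext_ref _ _ => psdJ.
set phi := max_entangled_vec C d; set c := (phi *m J *m adjmx phi) 0 0.
have c_ge0 : 0 <= c by case: psdJ => _; apply.
pose s : C := sqrtC d%:R^-1; pose f := sqrtC c.
have s_neq0 : s != 0 by rewrite sqrtC_eq0 invr_eq0 pnatr_eq0 -lt0n.
have f_ge0 : 0 <= f by rewrite sqrtC_ge0.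
have J_phi : (phi *m J *m adjmx phi) 0 0 =
    s * \sum_i (J *m adjmx phi) (mxtens_index (i, i)) 0.
  rewrite -mulmxA mxE sum_mxtens mulr_sumr; apply: eq_bigr => i _.
  rewrite (bigD1 i) //= [X in _ + X]big1 ?addr0.
    by rewrite max_entangled_vecE eqxx mulr1.
  by move=> j ne; rewrite max_entangled_vecE eq_sym (negbTE ne) mulr0 mul0r.
(* T = 0 when f = 0, since then f^-1 = 0. *)
pose T : 'M[C]_d :=
  \matrix_(i, j) (s^-1 * f^-1 * (J *m adjmx phi) (mxtens_index (i, j)) 0).
have TE i j : T i j = s^-1 * f^-1 * (J *m adjmx phi) (mxtens_index (i, j)) 0.
  by rewrite mxE.
clearbody T; exists T.
  (* The two factors [s^-1], one from [T] and one from [J_phi], multiply to [d], and [c / f = f],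
     also when [f = 0]. *)
  have -> : `|\tr T| = d%:R * f.
    rewrite -[RHS]ger0_norm ?mulr_ge0 ?ler0n //; congr `|_|.
    rewrite /mxtrace; under eq_bigr do rewrite TE.
    rewrite -mulr_sumr; have /(canRL (mulKf s_neq0)) -> := esym J_phi.
    rewrite -/c -[c]sqrtCK -/f mulrACA -invfM /s sqrt_dV invrK; congr (_ * _).
    have [->|f_neq0] := eqVneq f 0; first by rewrite invr0 mul0r.
    by rewrite expr2 mulKf.
  apply: ler_wpM2l; first exact: ler0n.
  by have := fidelity_pure_le phi psdJ; rewrite -max_entangled_pure.
(* Entry (i, j) of the left side is [s * T i j], which is why [T] carries the factor [s^-1]. *)
have liftT_phi : liftmx d T *m adjmx phi = f^-1 *: (J *m adjmx phi).
  apply/colP => k; case: (mxtens_indexP k) => i j.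
  have phiE k' b : adjmx phi (mxtens_index (k', b)) 0 = s * (k' == b)%:R.
    by rewrite 2!mxE max_entangled_vecE rmorphM /= conj_sqrt_dV rmorph_nat.
  rewrite [LHS]mxE sum_mxtens (bigD1 j) //= [X in _ + X]big1 ?addr0; last first.
    move=> k' ne; apply: big1 => b _; rewrite liftmxE phiE.
    case: (eqVneq j b) => [<-|_]; last by rewrite mulr0 mul0r.
    by rewrite (negbTE ne) !mulr0.
  rewrite (bigD1 j) //= [X in _ + X]big1 ?addr0; last first.
    by move=> b ne; rewrite liftmxE eq_sym (negbTE ne) mulr0 mul0r.
  rewrite liftmxE phiE eqxx !mulr1 TE [RHS]mxE mulrAC.
  by rewrite [s^-1 * _]mulrC -[_ * s]mulrA mulVf // mulr1.
(* The left side is the squared modulus of [v *m J *m adjmx phi] divided by [c]; Cauchy-Schwarz for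
   [v *m sqrtmx J] and [phi *m sqrtmx J] bounds it. For [c = 0] it is 0 by the convention on
   inverses. *)
have dom_J (v : 'rV_(d * d)) :
    (v *m (liftmx d T *m max_entangled C d *m adjmx (liftmx d T)) *m adjmx v) 0 0
    <= (v *m J *m adjmx v) 0 0.
  have -> : v *m (liftmx d T *m max_entangled C d *m adjmx (liftmx d T)) *m adjmx v
     = (v *m (liftmx d T *m adjmx phi)) *m adjmx (v *m (liftmx d T *m adjmx phi)).
    by rewrite max_entangled_pure !adjmxM !adjmxK !mulmxA.
  rewrite liftT_phi -scalemxAr mxE big_ord1 [adjmx _ _ _]mxE [_^T _ _]mxE.
  rewrite -normCK mxE normrM exprMn mulmxA.
  rewrite normfV [`|f|]ger0_norm // exprVn sqrtCK.
  have vJv_ge0 : 0 <= (v *m J *m adjmx v) 0 0 by case: psdJ => _; apply.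
  have [->|c_neq0] := eqVneq c 0; first by rewrite invr0 mul0r.
  rewrite ler_pdivrMl ?lt0r ?c_neq0 //.
  move: (sqrtmx J) (adjmx_sqrtmx psdJ) (sqrtmxK psdJ) => S adjS SS.
  have := adj_CauchySchwarz (v *m S) (phi *m S).
  by rewrite !adjmxM adjS !mulmxA -![_ *m S *m S]mulmxA SS mulrC.
move=> r X w psdX; rewrite -ext_ref_conj.
(* The vectors [g l] of [ext_ref_form] depend only on [w] and this factor of [X], not on the map, so
   [dom_J] compares the two sums term by term. *)
have -> : X = sqrtmx X *m adjmx (sqrtmx X) by rewrite adjmx_sqrtmx // sqrtmxK.
rewrite !ext_ref_form //; apply: ler_wpM2l; first exact: ler0n.
by apply: ler_sum => l _; rewrite ext_ref_conj; apply: dom_J.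
Qed.

End Choi.

(** * Pauli twirling *)

Section Pauli.
Variable C : numClosedFieldType.

(** In tensor form, the four products of a Pauli matrix with itself sum to twice the SWAP operator;
    the sixteen entries are checked one by one. *)
Lemma pauli1_swap (i j k l : 'I_2) :
  \sum_(c < 4) pauli1 C c i j * pauli1 C c k l = 2%:R * ((i == l) && (j == k))%:R.
Proof.
have ii : 'i * 'i = -1 :> C by rewrite -expr2 sqrCi.
rewrite !big_ord_recl big_ord0 /pauli1 /= addr0 !mxE.
case: i => [] [|[|[]]] // ?; case: j => [] [|[|[]]] // ?;
case: k => [] [|[|[]]] // ?; case: l => [] [|[|[]]] // ?;
rewrite -!(inj_eq val_inj) /= ?(mulr0, mul0r, mulr1, mul1r, addr0, add0r, expr0, expr1) //;
by rewrite ?(mulrN, mulNr, ii, opprK, mulr1, addrN, addNr, addr0, add0r).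
Qed.

Lemma pauli_twirl k (T : 'M[C]_(2 ^ k)) :
  \sum_(a : {ffun 'I_k -> 'I_4}) pauli C a *m T *m pauli C a =
  ((2 ^ k)%:R * \tr T)%:M.
Proof.
have swap (x y z w : 'I_(2 ^ k)) :
    \sum_(a : {ffun 'I_k -> 'I_4}) pauli C a x y * pauli C a z w =
    (2 ^ k)%:R * ((x == w) && (y == z))%:R.
  under eq_bigr do rewrite !mxE -big_split /=.
  (* The sum over Pauli words of a product over qubits becomes a product over qubits of one-qubit
     sums, giving SWAP on k-qubit registers. *)
  rewrite -(bigA_distr_bigA (fun q c =>
    pauli1 C c (bits x q) (bits y q) * pauli1 C c (bits z q) (bits w q))).
  under eq_bigr do rewrite pauli1_swap.
  rewrite big_split /= prodr_const card_ord natrX; congr (_ * _).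
  have prod_bool (b : 'I_k -> bool) : \prod_q (b q)%:R = [forall q, b q]%:R :> C.
    have [/forallP h|] := boolP [forall q, b q]; first by rewrite big1 // => q _; rewrite h.
    by rewrite negb_forall => /existsP[q /negbTE bq]; rewrite (bigD1 q) //= bq mul0r.
  have bitsE (u v : 'I_(2 ^ k)) : (u == v) = [forall q, bits u q == bits v q].
    rewrite -(can_eq (@bitsK k)); apply/eqP/forallP => [-> // | e].
    by apply/ffunP => q; apply/eqP.
  rewrite prod_bool; congr _%:R; congr nat_of_bool; rewrite !bitsE.
  apply/forallP/andP => [h|[/forallP h1 /forallP h2] q]; last by rewrite h1 h2.
  by split; apply/forallP => q; case/andP: (h q).
apply/matrixP => x w; rewrite summxE !mxE.
transitivity (\sum_y \sum_z T y z * \sum_a pauli C a x y * pauli C a z w).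
  under eq_bigr do rewrite mxE; rewrite exchange_big /=.
  under eq_bigr do under eq_bigr do rewrite mxE mulr_suml.
  under eq_bigr do rewrite exchange_big /=.
  rewrite exchange_big; apply: eq_bigr => y _; apply: eq_bigr => z _ /=.
  by rewrite mulr_sumr; apply: eq_bigr => a _; rewrite mulrAC mulrC.
rewrite -[RHS]mulr_natr -mulrA [_ * (x == w)%:R]mulrC /mxtrace mulr_sumr mulr_sumr.
apply: eq_bigr => y _; rewrite (bigD1 y) //= [X in _ + X]big1 ?addr0.
  by rewrite swap eqxx andbT mulrC -mulrA; congr (_ * _).
by move=> z ne; rewrite swap [y == z]eq_sym (negbTE ne) andbF !mulr0.
Qed.

End Pauli.

(** * The encoding isometry and the mean fidelity of twirled maps *)

Section Encode.
Variable C : numClosedFieldType.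

(** Sends the logical basis vector i to [U] applied to i on [L] and zeros elsewhere. With it the
    encoding has a single Kraus operator, hence is linear and completely positive. *)
Definition encoder n (L : {set 'I_n}) (U : 'M[C]_(2 ^ n)) :
    'M[C]_(2 ^ n, 2 ^ #|L|) :=
  U *m \matrix_(x, i) ((Defs.restrict L x == i) &&
                       (Defs.restrict (~: L) x == of_bits [ffun=> 0]))%:R.

Lemma encodeE n (L : {set 'I_n}) (U : 'M[C]_(2 ^ n)) :
  encode (L := L) U =1 conjmap (encoder L U).
Proof.
move=> psi; rewrite /encode /= /encoder adjmxM !mulmxA; congr (_ *m _).
rewrite -!mulmxA; congr (_ *m _); apply/matrixP => x y; rewrite !mxE.
rewrite (bigD1 (Defs.restrict L x)) //= [X in _ + X]big1 ?addr0; last first.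
  by move=> i ne; rewrite mxE eq_sym (negbTE ne) mul0r.
rewrite !mxE eqxx /= (bigD1 (Defs.restrict L y)) //= [X in _ + X]big1 ?addr0; last first.
  by move=> i ne; rewrite !mxE [_ == i]eq_sym (negbTE ne) rmorph0 mulr0.
by rewrite !mxE eqxx /= rmorph_nat mulrCA -natrM mulnb.
Qed.

Lemma liftmx_scalar m r (c : C) : liftmx r (c%:M : 'M_m) = c%:M.
Proof.
apply: eq_mxtens => i a j b; rewrite liftmxE !mxE.
rewrite (can_eq (@mxtens_indexK m r)) xpair_eqE.
by case: eqP; case: eqP; rewrite ?mulr1 ?mulr0.
Qed.

Lemma liftmx_sum m n r I (s : seq I) (F : I -> 'M[C]_(n, m)) :
  liftmx r (\sum_(i <- s) F i) = \sum_(i <- s) liftmx r (F i).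
Proof.
apply: eq_mxtens => x a y b; rewrite liftmxE !summxE mulr_suml.
by apply: eq_bigr => i _; rewrite liftmxE.
Qed.

Lemma eq_pauli_mean k (f g : 'M[C]_(2 ^ k) -> C) :
  f =1 g -> pauli_mean f = pauli_mean g.
Proof. by move=> fg; rewrite /pauli_mean; under eq_bigr do rewrite fg. Qed.

Lemma twirled_fidelity_mean k (Phi : {linear 'M[C]_(2 ^ k) -> 'M[C]_(2 ^ k)})
    r (psi : 'M[C]_(2 ^ k * r)) :
  completely_positive Phi -> is_state psi ->
  choi_fidelity Phi <=
  pauli_mean (fun P => fidelity psi (ext_ref (conjmap P \o Phi \o conjmap P) psi)).
Proof.
move=> cpPhi [psd_psi tr_psi]; have d_gt0 : (0 < 2 ^ k)%N by rewrite expn_gt0.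
have psdJ : psdmx (ext_ref Phi (max_entangled C (2 ^ k))).
  apply: cpPhi; rewrite max_entangled_pure.
  by rewrite -{2}[max_entangled_vec _ _]adjmxK; apply: psdmx_gram.
have [T choiT domT] := choi_dominating_operator d_gt0 psdJ.
have d_neq0 : (2 ^ k)%:R != 0 :> C by rewrite pnatr_eq0 -lt0n.
(* Encoding and decoding are both twisted by the same [P], so the dominated Kraus operator is
   [P *m T *m P], the form averaged by [pauli_twirl]. *)
have fid_ge P : `|\tr (liftmx r (P *m T *m P) *m psi)| <=
    fidelity psi (ext_ref (conjmap P \o Phi \o conjmap P) psi).
  have psdX := psdmx_conj (liftmx r P) psd_psi.
  rewrite -compA ext_ref_comp ext_ref_conj ext_ref_comp ext_ref_conj.
  apply: fidelity_ge => // [|w]; first exact/psdmx_conj/cpPhi.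
  have := domT r _ (w *m liftmx r P) psdX.
  by rewrite !liftmxM !adjmxM !mulmxA.
have choi_le : choi_fidelity Phi <= (2 ^ k)%:R^-1 * `|\tr T|.
  by rewrite ler_pdivlMl ?ltr0n.
apply: le_trans choi_le _; rewrite /pauli_mean.
apply: le_trans (_ : _ <= (4 ^ k)%:R^-1 * \sum_(a : {ffun 'I_k -> 'I_4})
  `|\tr (liftmx r (pauli C a *m T *m pauli C a) *m psi)|) _; last first.
  by rewrite ler_wpM2l ?invr_ge0 ?ler0n //; apply: ler_sum.
(* The mean of the moduli is at least the modulus of the mean, which the twirl makes a scalar; [psi]
   then enters only by its trace 1. *)
apply: le_trans (ler_wpM2l _ (ler_norm_sum _ _ _)); last by rewrite invr_ge0 ler0n.
rewrite -raddf_sum /= -mulmx_suml -liftmx_sum pauli_twirl liftmx_scalar.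
rewrite mul_scalar_mx linearZ /= tr_psi mulr1 normrM normr_nat mulrA.
(* The number of Paulis is the squared dimension: one factor cancels the twirl constant, the other
   leaves the average of the diagonal of [T]. *)
by rewrite (_ : 4 = 2 * 2)%N // expnMn natrM invfM mulrVK ?unitfE.
Qed.

End Encode.

(** * The bound for Pauli-twisted encodings and decodings *)

Local Open Scope complex_scope.

Theorem proposition1 (R : realType) (n : nat) (L : {set 'I_n})
    (U : 'M[R[i]]_(2 ^ n))
    (N : {linear 'M[R[i]]_(2 ^ n) -> 'M[R[i]]_(2 ^ n)})
    (D : {linear 'M[R[i]]_(2 ^ n) -> 'M[R[i]]_(2 ^ #|L|)})
    (U_unitary : U \is unitarymx)
    (N_channel : is_channel N)
    (D_channel : is_channel D)
    (r : nat) (psi : 'M[R[i]]_(2 ^ #|L| * r))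
    (psi_state : is_state psi) :
  choi_fidelity (D \o N \o encode U) <=
  pauli_mean (fun P : 'M[R[i]]_(2 ^ #|L|) =>
    fidelity psi (ext_ref (decodeP D P \o N \o encodeP U P) psi)).
Proof.
pose Phi : {linear 'M[R[i]]_(2 ^ #|L|) -> 'M[R[i]]_(2 ^ #|L|)} :=
  D \o N \o conjmap (encoder L U).
have cpPhi : completely_positive Phi.
  move=> s X psdX; rewrite /Phi /= ext_ref_comp ext_ref_comp ext_ref_conj.
  case: D_channel => cpD _; case: N_channel => cpN _.
  exact/cpD/cpN/psdmx_conj.
have -> : choi_fidelity (D \o N \o encode U) = choi_fidelity Phi.
  congr fidelity; apply: eq_ext_ref => X /=.
  by rewrite encodeE.
(* The twisted encoding first conjugates by [P] and the twisted decoding does so last, so all of the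
   twist sits outside [Phi]. *)
have eqP P : fidelity psi (ext_ref (decodeP D P \o N \o encodeP U P) psi) =
    fidelity psi (ext_ref (conjmap P \o Phi \o conjmap P) psi).
  rewrite (@eq_ext_ref _ _ _ _ _ (conjmap P \o Phi \o conjmap P)) // => X /=.
  by rewrite /decodeP /encodeP encodeE.
rewrite (eq_pauli_mean eqP); exact: twirled_fidelity_mean.
Qed.
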